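(* Let $k \ge 1$ be an integer. Let $G$ be a connected graph that contains a cycle, and let $C$ be a shortest cycle in $G$. If $v$ is a vertex of $G$ outside $C$ that $k$-dominates at least $2k$ vertices of $C$, then there exist two vertices $u, w \in V(C)$ that are both $k$-dominated by $v$ and such that a shortest $(u,v)$-path does not contain $w$ and a shortest $(v,w)$-path does not contain $u$.
   Context: All graphs are finite, simple and undirected. For vertices $x,y$ of $G$, the distance $d_G(x,y)$ is the number of edges of a shortest $(x,y)$-path in $G$. A vertex $v$ $k$-dominates a vertex $x$ (in $G$) if $d_G(v,x) \le k$. Shortest paths are taken in $G$. *)

(* Defs.v *)
From mathcomp Require Import all_boot.

Set Implicit Arguments.
Unset Strict Implicit.
Unset Printing Implicit Defensive.

Section Graph.

(* A finite simple graph is a symmetric irreflexive adjacency relation e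
   on T; both properties are hypotheses of the statements using it. *)
Variables (T : finType) (e : rel T).

(* The vertices of the (x, y)-path are x :: p, so its number of edges is
   size p; paths do not repeat vertices. *)
Definition xypath (x y : T) (p : seq T) : bool :=
  [&& path e x p, last x p == y & uniq (x :: p)].

Definition shortest_path (x y : T) (p : seq T) : Prop :=
  xypath x y p /\ forall q, xypath x y q -> size p <= size q.

(* The least number of edges of an (x, y)-path. A path has fewer than #|T|
   edges; the value is #|T| when x and y lie in different components. *)
Definition dist (x y : T) : nat :=
  find (fun n => [exists p : n.-tuple T, xypath x y p]) (iota 0 #|T|).

Definition dominates (k : nat) (v x : T) : bool := dist v x <= k.

Definition connected_graph : Prop := forall x y : T, connect e x y.

(* The edges of the cycle c join cyclically consecutive entries of c, so its
   length is size c. The bound excludes the closed walk x, y, x that runs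
   twice along one edge. *)
Definition graph_cycle (c : seq T) : bool := ucycleb e c && (2 < size c).

Definition shortest_cycle (c : seq T) : Prop :=
  graph_cycle c /\ forall c', graph_cycle c' -> size c <= size c'.

Lemma xypath_size x y p : xypath x y p -> size p < #|T|.
Proof.
case/and3P=> _ _ Up; rewrite -[(size p).+1]/(size (x :: p)).
by rewrite -(card_uniqP Up) max_card.
Qed.

Lemma dist_shortest_path x y p : shortest_path x y p -> dist x y = size p.
Proof.
case=> xp pmin; have sp := xypath_size xp.
rewrite /dist; set a := (fun n => _).
have ap : a (size p) by apply/existsP; exists (in_tuple p).
have ha : has a (iota 0 #|T|).
  by apply/hasP; exists (size p) => //; rewrite mem_iota.
have lt := ha; rewrite has_find size_iota in lt.
apply/eqP; rewrite eqn_leq; apply/andP; split.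
  rewrite leqNgt; apply/negP=> /(before_find 0).
  by rewrite nth_iota // add0n ap.
have := nth_find 0 ha; rewrite nth_iota // add0n => /existsP[q /pmin].
by rewrite size_tuple.
Qed.

Lemma shortest_path_exists x y :
  connect e x y -> exists p, shortest_path x y p.
Proof.
case/connectP=> p0 /shortenP[p pp Up _ def_y].
pose P n := [exists p : n.-tuple T, xypath x y p].
have exP : exists n, P n.
  exists (size p); apply/existsP; exists (in_tuple p) => /=.
  by rewrite /xypath pp def_y eqxx Up.
case: (ex_minnP exP) => n /existsP[q xq] nmin.
exists q; split=> // r xr; rewrite size_tuple; apply: nmin.
by apply/existsP; exists (in_tuple r).
Qed.

End Graph.

(* Main.v *)
Require Import Defs.
From mathcomp Require Import all_boot.

Set Implicit Arguments.
Unset Strict Implicit.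
Unset Printing Implicit Defensive.

(** The dominated vertices of [C] have distance between [1] and [k] from [v],
    and there are at least [2 * k > k] of them, so two of them, [u] and [w],
    are at the same distance from [v]. An inner vertex of a shortest path from
    [v] to [u] is strictly closer to [v] than [u], hence it is not [w]; and
    symmetrically. *)

Lemma dist_le_size (T : finType) (e : rel T) (x y : T) (p : seq T) :
  xypath e x y p -> dist e x y <= size p.
Proof.
move=> xp; have /and3P[pp /eqP lp _] := xp.
have [|q xq] := @shortest_path_exists T e x y.
  by apply/connectP; exists p.
by rewrite (dist_shortest_path xq); case: xq => _; apply.
Qed.

Lemma dist_gt0 (T : finType) (e : rel T) (x y : T) :
  connect e x y -> x != y -> 0 < dist e x y.
Proof.
move=> /shortest_path_exists[p xp]; rewrite (dist_shortest_path xp).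
by case: p xp => // -[/and3P[_ /eqP/= -> _] _]; rewrite eqxx.
Qed.

(** Cut the path at [w]: the first piece is an [(x, w)]-path, and the second has at least one edge
    because [w] is not [y]. *)
Lemma dist_lt_on_shortest_path (T : finType) (e : rel T) (x y w : T)
    (p : seq T) :
  shortest_path e x y p -> w \in x :: p -> w != y -> dist e x w < dist e x y.
Proof.
move=> xp; rewrite (dist_shortest_path xp); case: xp => + _ w_in.
case/splitPl: w_in => p1 p2 lp1; rewrite /xypath cat_path last_cat lp1 -cat_cons.
rewrite cat_uniq => /and3P[/andP[pp1 _] lp2 /andP[Up1 _]] w_neq.
have p2_gt0 : 0 < size p2 by case: p2 lp2 => //=; rewrite (negPf w_neq).
have /dist_le_size/leq_ltn_trans : xypath e x w p1.
  by rewrite /xypath pp1 lp1 eqxx.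
by apply; rewrite size_cat -addn1 leq_add2l.
Qed.

(** The encoding keeps the first vertex apart from the rest, so the reversed path has tail
    [rev (belast x p)]. *)
Lemma cons_rev_belast (T : Type) (x : T) (p : seq T) :
  last x p :: rev (belast x p) = rev (x :: p).
Proof. by rewrite [in RHS]lastI rev_rcons. Qed.

Lemma xypath_rev (T : finType) (e : rel T) (x y : T) (p : seq T) :
  symmetric e -> xypath e x y p -> xypath e y x (rev (belast x p)).
Proof.
move=> e_sym /and3P[pp /eqP <- Up]; apply/and3P; split.
- by rewrite rev_path (eq_path (e' := e)).
(* By computation, [last] of a nonempty list ignores its default, so the whole vertex list can be
   exposed. *)
- rewrite -[last _ _]/(last x (last x p :: rev (belast x p))).
  by rewrite cons_rev_belast rev_cons last_rcons.
- by rewrite cons_rev_belast rev_uniq.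
Qed.

Lemma shortest_path_rev (T : finType) (e : rel T) (x y : T) (p : seq T) :
  symmetric e -> shortest_path e x y p ->
  shortest_path e y x (rev (belast x p)).
Proof.
move=> e_sym [xp pmin]; split=> [|q /(xypath_rev e_sym)/pmin].
  exact: xypath_rev.
by rewrite !size_rev !size_belast.
Qed.

Lemma same_dist_pair (T : finType) (e : rel T) (k : nat) (v : T)
    (D : {set T}) :
  (forall x, x \in D -> 0 < dist e v x <= k) -> k < #|D| ->
  exists u w, [/\ u \in D, w \in D, u != w & dist e v u = dist e v w].
Proof.
move=> D_dist k_lt.
have : ~~ dinjectiveb (dist e v) [in D].
  (* Pigeonhole: if injective, the distances form a duplicate-free list inside [iota 1 k], so there
     are at most [k] of them. *)
  apply: contraL k_lt => /uniq_leq_size le_size; rewrite -leqNgt.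
  rewrite -(size_iota 1 k) cardE -(size_map (dist e v)); apply: le_size => n.
  by case/mapP=> x; rewrite mem_enum => /D_dist ? ->; rewrite mem_iota.
by case/dinjectivePn=> u Du [w /andP[wu Dw] ?]; exists u, w; rewrite eq_sym.
Qed.

Theorem lemma6 (T : finType) (e : rel T)
    (e_sym : symmetric e) (e_irr : irreflexive e)
    (e_conn : connected_graph e)
    (k : nat) (k_gt0 : 1 <= k)
    (C : seq T) (C_min : shortest_cycle e C)
    (v : T) (v_notin_C : v \notin C)
    (v_dom : 2 * k <= #|[set x in C | dominates e k v x]|) :
  exists u w : T,
    [/\ u \in C, w \in C & u != w] /\
    [/\ dominates e k v u & dominates e k v w] /\
    (forall p : seq T, shortest_path e u v p -> w \notin u :: p) /\
    (forall p : seq T, shortest_path e v w p -> u \notin v :: p).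
Proof.
have [||u [w [+ + uw duw]]] :=
  @same_dist_pair T e k v [set x in C | dominates e k v x].
- move=> x; rewrite inE => /andP[Cx vx]; apply/andP; split=> //; apply: dist_gt0 => //.
  by apply: contraNneq v_notin_C => ->.
(* Here [k_gt0] gives [k + 1 <= k + k]. *)
- by apply: leq_trans v_dom; rewrite mul2n -addnn -addn1 leq_add2l.
rewrite !inE => /andP[Cu du] /andP[Cw dw]; exists u, w; do 3!split=> //.
- move=> p up; apply/negP=> w_in.
  (* Distances are compared from [v], so the path from [u] to [v] is reversed; its vertex set is
     unchanged. *)
  have := dist_lt_on_shortest_path (shortest_path_rev e_sym up) (w := w).
  case: (up) => /and3P[_ /eqP lp _] _.
  rewrite -{1}lp cons_rev_belast mem_rev => /(_ w_in).
  by rewrite eq_sym uw duw ltnn => /(_ isT).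
- move=> p vp; apply/negP=> /(dist_lt_on_shortest_path vp)/(_ uw).
  by rewrite duw ltnn.
Qed.
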